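(* Let $X$ be an infinite set and let $\mathcal{Z}\subseteq\mathcal{P}(X)$ be closed under finite unions with $[X]^{<\omega}\subseteq\mathcal{Z}$. Then (in $\mathbf{ZF}$): (a) The space $\mathbf{S}_{\mathcal{P}}(X,\mathcal{Z})$ is homogeneous if and only if $\mathcal{Z}=\mathcal{P}(X)$. (b) If $\mathcal{Z}$ and $\mathcal{A}$ are bornologies on $X$ such that $\mathcal{A}\subseteq\mathcal{Z}$, then the space $\mathbf{S}_{\mathcal{A}}(X,\mathcal{Z})$ is homogeneous. (c) If $\mathcal{Z}$ is a bornology on $X$, then the space $\mathbf{S}(X,\mathcal{Z})$ is homogeneous.
   Context: The background theory is $\mathbf{ZF}$ (no axiom of choice). $[X]^{<\omega}$ is the set of finite subsets of $X$. For $\mathcal{A}\subseteq\mathcal{P}(X)$, $\mathbf{S}_{\mathcal{A}}(X,\mathcal{Z})$ is the set $\mathcal{A}$ with the topology $\tau_{\mathcal{A}}[\mathcal{Z}]$ consisting of all $V\subseteq\mathcal{A}$ such that for every $x\in V$ there is $z\in\mathcal{Z}$ with $x\cap z=\emptyset$ and $\{y\in\mathcal{A}:x\subseteq y\subseteq X\setminus z\}\subseteq V$. $\mathbf{S}_{\mathcal{P}}(X,\mathcal{Z})=\mathbf{S}_{\mathcal{P}(X)}(X,\mathcal{Z})$ and $\mathbf{S}(X,\mathcal{Z})=\mathbf{S}_{[X]^{<\omega}}(X,\mathcal{Z})$. A bornology on $X$ is an ideal $\mathcal{I}$ of subsets of $X$ (closed under subsets and finite unions, possibly improper) with $\bigcup\mathcal{I}=X$.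 A topological space is homogeneous if for every pair $x_1,x_2$ of distinct points there is an autohomeomorphism $h$ of the space with $h(x_1)=x_2$. *)

(* Defs.v *)
(* Only the Rocq prelude is used.  A claim "in ZF" is rendered semantically, as
   truth in every first-order structure satisfying the axioms of ZF.  Rocq's own
   logical axioms are part of the metatheory: they do not make the axiom of
   choice true inside such a structure, because the separation and replacement
   schemas range over first-order formulas only. *)

Set Implicit Arguments.

Record set_structure : Type := SetStructure {
  univ :> Type;
  mem : univ -> univ -> Prop
}.
Arguments mem {_} _ _.

Notation "x '∈' y" := (mem x y) (at level 70, no associativity).

(* First-order formulas over {∈, =}, with de Bruijn indices. *)
Inductive formula : Type :=
| fMem (i j : nat)
| fEq (i j : nat)
| fFalse
| fImp (p q : formula)
| fAll (p : formula).

Definition scons (T : Type) (a : T) (e : nat -> T) : nat -> T :=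
  fun i => match i with O => a | S j => e j end.

Fixpoint sat (M : set_structure) (e : nat -> M) (p : formula) : Prop :=
  match p with
  | fMem i j => e i ∈ e j
  | fEq i j => e i = e j
  | fFalse => False
  | fImp p q => sat M e p -> sat M e q
  | fAll p => forall a : M, sat M (scons a e) p
  end.
Arguments sat {M} e p.

Section Notions.
Context {M : set_structure}.
Implicit Types x y z a b p s t u v w e f n A B F I P V X Z : M.

Definition subset x y : Prop := forall t, t ∈ x -> t ∈ y.
Definition disjoint x y : Prop := forall t, t ∈ x -> ~ t ∈ y.

(* The set operations are given by their graphs: the first argument is the value. *)
Definition is_empty e : Prop := forall t, ~ t ∈ e.
Definition is_upair p x y : Prop := forall t, t ∈ p <-> t = x \/ t = y.
Definition is_union u F : Prop := forall t, t ∈ u <-> exists x, x ∈ F /\ t ∈ x.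
Definition is_cup w u v : Prop := forall t, t ∈ w <-> t ∈ u \/ t ∈ v.
Definition is_diff w u v : Prop := forall t, t ∈ w <-> t ∈ u /\ ~ t ∈ v.
Definition is_power P x : Prop := forall y, y ∈ P <-> subset y x.
Definition is_succ s n : Prop := forall t, t ∈ s <-> t ∈ n \/ t = n.

(* Kuratowski pair {{x}, {x, y}}. *)
Definition is_opair p x y : Prop :=
  exists s t, is_upair s x x /\ is_upair t x y /\ is_upair p s t.

Definition inductive w : Prop :=
  (exists e, is_empty e /\ e ∈ w) /\
  (forall n, n ∈ w -> exists s, is_succ s n /\ s ∈ w).

(* n is a von Neumann natural number, i.e. n ∈ ω. *)
Definition is_natural n : Prop := forall w, inductive w -> n ∈ w.

Definition maps f x y : Prop := exists p, is_opair p x y /\ p ∈ f.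

Definition function f A B : Prop :=
  (forall p, p ∈ f -> exists x y, x ∈ A /\ y ∈ B /\ is_opair p x y) /\
  (forall x, x ∈ A -> exists! y, maps f x y).

Definition bijection f A B : Prop :=
  function f A B /\ (forall y, y ∈ B -> exists! x, maps f x y).

Definition finite x : Prop := exists n f, is_natural n /\ bijection f x n.

Definition is_finite_subsets F X : Prop :=
  forall x, x ∈ F <-> subset x X /\ finite x.

(* The empty union and the binary unions generate all finite unions. *)
Definition closed_finite_unions F : Prop :=
  (forall e, is_empty e -> e ∈ F) /\
  (forall u v w, u ∈ F -> v ∈ F -> is_cup w u v -> w ∈ F).

Definition bornology I X : Prop :=
  (forall x, x ∈ I -> subset x X) /\
  (forall x y, x ∈ I -> subset y x -> y ∈ I) /\
  closed_finite_unions I /\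
  is_union X I.

(* A topology on the set A is passed as the predicate "is an open set". *)
Definition continuous f A (open : M -> Prop) : Prop :=
  forall V U, open V ->
    (forall x, x ∈ U <-> x ∈ A /\ exists y, maps f x y /\ y ∈ V) -> open U.

Definition open_map f A (open : M -> Prop) : Prop :=
  forall U V, open U ->
    (forall y, y ∈ V <-> y ∈ A /\ exists x, x ∈ U /\ maps f x y) -> open V.

Definition autohomeomorphism f A (open : M -> Prop) : Prop :=
  bijection f A A /\ continuous f A open /\ open_map f A open.

Definition homogeneous A (open : M -> Prop) : Prop :=
  forall x1 x2, x1 ∈ A -> x2 ∈ A -> x1 <> x2 ->
    exists h, autohomeomorphism h A open /\ maps h x1 x2.

(* V ∈ τ_A[Z], the topology of the space S_A(X, Z). *)
Definition tau X Z A V : Prop :=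
  subset V A /\
  forall x, x ∈ V ->
    exists z, z ∈ Z /\ disjoint x z /\
      forall c, is_diff c X z ->
      forall y, y ∈ A -> subset x y -> subset y c -> y ∈ V.

Definition S_homogeneous X Z A : Prop := homogeneous A (tau X Z A).

End Notions.

Record ZF (M : set_structure) : Prop := {
  ZF_extensionality : forall x y : M, (forall t, t ∈ x <-> t ∈ y) -> x = y;
  ZF_foundation : forall x : M, (exists y, y ∈ x) ->
    exists y, y ∈ x /\ disjoint y x;
  ZF_pairing : forall x y : M, exists p, is_upair p x y;
  ZF_union : forall F : M, exists u, is_union u F;
  ZF_power : forall x : M, exists P, is_power P x;
  ZF_infinity : exists w : M, inductive w;
  ZF_separation : forall (p : formula) (e : nat -> M) (a : M),
    exists b : M, forall x, x ∈ b <-> x ∈ a /\ sat (scons x e) p;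
  ZF_replacement : forall (p : formula) (e : nat -> M) (a : M),
    (forall x, x ∈ a -> forall y y',
       sat (scons x (scons y e)) p -> sat (scons x (scons y' e)) p -> y = y') ->
    exists b : M, forall y,
      y ∈ b <-> exists x, x ∈ a /\ sat (scons x (scons y e)) p
}.

(* Main.v *)
(* The involution h(y) = y Δ d, where d = x1 Δ x2, exchanges x1 and x2.  When A is
   closed under Δ and contained in an ideal Z, it is continuous on S_A(X, Z): if
   z ∈ Z witnesses openness at y Δ d, then (z ∪ d) \ y ∈ Z witnesses openness of
   the preimage at y, because it freezes the trace on d.  This gives (b), (c)
   and the case Z = P(X) of (a).  Conversely, X is an isolated point of S_P(X, Z); if
   the space is homogeneous, each X \ x is isolated, and this forces x ∈ Z. *)

From Stdlib Require Import Classical.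
Require Import Defs.

(** * First-order definability of predicates *)

Section Definability.
Context {M : set_structure}.
Implicit Types (P Q : (nat -> M) -> Prop) (R : M -> (nat -> M) -> Prop).

(** One formula must serve all environments; this is what lets a Rocq predicate enter the separation
    and replacement schemas. *)
Definition definable P : Prop := exists p, forall e, sat e p <-> P e.

Lemma definable_mem i j : definable (fun e => e i ∈ e j).
Proof. exists (fMem i j); reflexivity. Qed.

Lemma definable_eq i j : definable (fun e => e i = e j).
Proof. exists (fEq i j); reflexivity. Qed.

Lemma definable_False : definable (fun _ => False).
Proof. exists fFalse; reflexivity. Qed.

Lemma definable_imp P Q :
  definable P -> definable Q -> definable (fun e => P e -> Q e).
Proof.
  intros [p Hp] [q Hq]; exists (fImp p q); intro e; simpl.
  rewrite Hp, Hq; reflexivity.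
Qed.

(** The bound variable becomes index 0 and the other indices shift by one; reading [scons a e] this
    way gives back [a] and [e] by conversion. *)
Lemma definable_all R :
  definable (fun e => R (e 0) (fun i => e (S i))) ->
  definable (fun e => forall a, R a e).
Proof.
  intros [p Hp]; exists (fAll p); intro e; simpl.
  split; intros H a; apply (Hp (scons a e)), H.
Qed.

Lemma definable_equiv P Q :
  (forall e, P e <-> Q e) -> definable P -> definable Q.
Proof.
  intros H [p Hp]; exists p; intro e; rewrite Hp; apply H.
Qed.

(** Formulas are built with falsity, implication and universal quantification only, so conjunction,
    and likewise disjunction and existence below, go through their classical encodings. *)
Lemma definable_and P Q :
  definable P -> definable Q -> definable (fun e => P e /\ Q e).
Proof.
  intros HP HQ.
  apply definable_equiv with (fun e => (P e -> Q e -> False) -> False);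
    [intro e; destruct (classic (P e)), (classic (Q e)); tauto|].
  repeat apply definable_imp; auto using definable_False.
Qed.

Lemma definable_or P Q :
  definable P -> definable Q -> definable (fun e => P e \/ Q e).
Proof.
  intros HP HQ.
  apply definable_equiv with (fun e => (P e -> False) -> Q e);
    [intro e; destruct (classic (P e)); tauto|].
  repeat apply definable_imp; auto using definable_False.
Qed.

Lemma definable_ex R :
  definable (fun e => R (e 0) (fun i => e (S i))) ->
  definable (fun e => exists a, R a e).
Proof.
  intro HR.
  apply definable_equiv with (fun e => (forall a, R a e -> False) -> False).
  - intro e; split; [intro H; apply NNPP; firstorder | firstorder].
  - apply definable_imp; [apply definable_all | apply definable_False].
    apply definable_imp; [exact HR | apply definable_False].
Qed.

End Definability.

(** Set notions are unfolded down to membership and equality; the formula is then built along the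
    logical structure. *)
Ltac definability :=
  cbv beta delta [finite is_natural inductive bijection function maps is_opair
    is_upair is_succ is_cup is_empty subset unique iff not];
  repeat (cbv beta;
    first [ apply definable_mem | apply definable_eq | apply definable_False
          | apply definable_and | apply definable_or
          | apply definable_all | apply definable_ex | apply definable_imp ]).

(** * Basic set operations inside a model of ZF *)

Section SetTheory.
Context {M : set_structure} (hM : ZF M).
Implicit Types a b c d e f m n p s t u v w x y z A B X Z : M.

Definition is_symdiff s x d : Prop := forall t, t ∈ s <-> ~ (t ∈ x <-> t ∈ d).

(* The environment [r] carries the parameters of the separation instance. *)
Lemma separation (Q : M -> (nat -> M) -> Prop) (r : nat -> M) a :
  definable (fun r => Q (r 0) (fun i => r (S i))) ->
  exists b, forall x, x ∈ b <-> x ∈ a /\ Q x r.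
Proof.
  intros [p Hp]; destruct (ZF_separation hM p r a) as [b Hb].
  exists b; intro x; rewrite (Hb x), (Hp (scons x r)); reflexivity.
Qed.

Lemma upair_exists x y : exists p, is_upair p x y.
Proof. apply (ZF_pairing hM). Qed.

Lemma singleton_exists x : exists s, forall t, t ∈ s <-> t = x.
Proof.
  destruct (upair_exists x x) as [s Hs]; exists s; intro t; rewrite (Hs t); tauto.
Qed.

Lemma cup_exists u v : exists w, is_cup w u v.
Proof.
  destruct (upair_exists u v) as [p Hp], (ZF_union hM p) as [w Hw].
  exists w; intro t; rewrite (Hw t); split.
  - intros [x [Hx Ht]]; apply Hp in Hx; destruct Hx; subst; tauto.
  - intros [Ht | Ht]; [exists u | exists v]; split; auto; apply Hp; auto.
Qed.

Lemma diff_exists u v : exists w, is_diff w u v.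
Proof.
  apply (separation (fun t r => ~ t ∈ r 0) (fun _ => v) u); definability.
Qed.

Lemma symdiff_exists x d : exists s, is_symdiff s x d.
Proof.
  destruct (cup_exists x d) as [w Hw].
  destruct (separation (fun t r => ~ (t ∈ r 0 <-> t ∈ r 1))
              (scons x (fun _ => d)) w) as [s Hs]; [definability|].
  exists s; intro t; rewrite (Hs t), (Hw t); simpl; tauto.
Qed.

Lemma adjoin_exists x a : exists w, forall t, t ∈ w <-> t ∈ x \/ t = a.
Proof.
  destruct (singleton_exists a) as [s Hs], (cup_exists x s) as [w Hw].
  exists w; intro t; rewrite (Hw t), (Hs t); tauto.
Qed.

(** * Ordered pairs and functions *)

Lemma opair_exists x y : exists p, is_opair p x y.
Proof.
  destruct (upair_exists x x) as [s Hs], (upair_exists x y) as [t Ht].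
  destruct (upair_exists s t) as [p Hp]; exists p, s, t; auto.
Qed.

Lemma opair_functional p q x y : is_opair p x y -> is_opair q x y -> p = q.
Proof.
  intros (s & t & Hs & Ht & Hp) (s' & t' & Hs' & Ht' & Hq).
  assert (s = s') by (apply (ZF_extensionality hM); intro a; rewrite (Hs a), (Hs' a); tauto).
  assert (t = t') by (apply (ZF_extensionality hM); intro a; rewrite (Ht a), (Ht' a); tauto).
  subst; apply (ZF_extensionality hM); intro a; rewrite (Hp a), (Hq a); tauto.
Qed.

Lemma opair_inj p x y x' y' : is_opair p x y -> is_opair p x' y' -> x = x' /\ y = y'.
Proof.
  intros (s & t & Hs & Ht & Hp) (s' & t' & Hs' & Ht' & Hq).
  assert (x = x').
  (* The singleton {x'} is {x} or {x, y}, and x lies in both. *)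
  { assert (H : s' ∈ p) by (apply Hq; auto).
    apply Hp in H; destruct H; subst s'.
    - assert (Hx : x ∈ s) by (apply Hs; auto). apply Hs' in Hx; tauto.
    - assert (Hx : x ∈ t) by (apply Ht; auto). apply Hs' in Hx; tauto. }
  subst x'; split; [reflexivity|].
  assert (Hy : y ∈ t) by (apply Ht; auto).
  assert (Hy' : y' ∈ t') by (apply Ht'; auto).
  (* If {x, y} is the singleton {x}, then y = x, and {x, y'} collapses to {x} as well. *)
  assert (Ht1 : t = s' \/ t = t') by (apply Hq, Hp; auto).
  assert (Ht2 : t' = s \/ t' = t) by (apply Hp, Hq; auto).
  destruct Ht1 as [-> | ->];
    [apply Hs' in Hy | apply Ht' in Hy; apply Ht in Hy'; intuition congruence].
  assert (y = x) by tauto; subst y.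
  destruct Ht2 as [-> | ->]; [apply Hs in Hy' | apply Ht in Hy']; intuition congruence.
Qed.

(* The index shift in the first hypothesis matches the formula
   "exists y, Q x y /\ p = (x, y)" used in the replacement instance. *)
Lemma graph_exists (Q : M -> M -> (nat -> M) -> Prop) (r : nat -> M) A B :
  definable (fun r => Q (r 1) (r 0) (fun i => r (S (S (S i))))) ->
  (forall x, x ∈ A -> exists! y, Q x y r) ->
  (forall x y, x ∈ A -> Q x y r -> y ∈ B) ->
  exists f, function f A B /\ forall x y, maps f x y <-> x ∈ A /\ Q x y r.
Proof.
  intros HQ Hfun HB.
  (* Under the existential quantifier index 0 is y, 1 is x, 2 is the pair, and the parameters start
     at 3. *)
  assert (HD : definable (fun r : nat -> M =>
    exists y, Q (r 0) y (fun i => r (S (S i))) /\ is_opair (r 1) (r 0) y)).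
  { apply (definable_ex (fun y r =>
      Q (r 0) y (fun i => r (S (S i))) /\ is_opair (r 1) (r 0) y)).
    apply definable_and; [exact HQ | definability]. }
  destruct HD as [q Hq].
  assert (Hsat : forall x p, sat (scons x (scons p r)) q <->
                  exists y, Q x y r /\ is_opair p x y)
    by (intros x p; apply Hq).
  destruct (ZF_replacement hM q r A) as [f Hf].
  { intros x Hx p p' Hp Hp'; apply Hsat in Hp, Hp'.
    destruct Hp as (y & Hy & Hp), Hp' as (y' & Hy' & Hp').
    destruct (Hfun x Hx) as (y0 & _ & Hu).
    rewrite <- (Hu y Hy) in Hp; rewrite <- (Hu y' Hy') in Hp'.
    exact (opair_functional _ _ _ _ Hp Hp'). }
  assert (Hmaps : forall x y, maps f x y <-> x ∈ A /\ Q x y r).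
  { intros x y; split.
    - intros (p & Hp & Hpf); apply Hf in Hpf; destruct Hpf as (x' & Hx' & Hs).
      apply Hsat in Hs; destruct Hs as (y' & Hy' & Hp').
      destruct (opair_inj _ _ _ _ _ Hp Hp'); subst; auto.
    - intros [Hx Hy]; destruct (opair_exists x y) as [p Hp].
      exists p; split; [exact Hp|]; apply Hf; exists x; split; [exact Hx|].
      apply Hsat; exists y; auto. }
  exists f; split; [split | exact Hmaps].
  - intros p Hp; apply Hf in Hp; destruct Hp as (x & Hx & Hs).
    apply Hsat in Hs; destruct Hs as (y & Hy & Hp).
    exists x, y; eauto.
  - intros x Hx; destruct (Hfun x Hx) as (y & Hy & Hu).
    exists y; split; [apply Hmaps; auto|].
    intros y' Hy'; apply Hu, Hmaps, Hy'.
Qed.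

Lemma function_domain f A B x y : function f A B -> maps f x y -> x ∈ A.
Proof.
  intros [Hf _] (p & Hp & Hpf); destruct (Hf p Hpf) as (x' & y' & Hx & _ & Hp').
  destruct (opair_inj _ _ _ _ _ Hp Hp'); congruence.
Qed.

Lemma function_codomain f A B x y : function f A B -> maps f x y -> y ∈ B.
Proof.
  intros [Hf _] (p & Hp & Hpf); destruct (Hf p Hpf) as (x' & y' & _ & Hy & Hp').
  destruct (opair_inj _ _ _ _ _ Hp Hp'); congruence.
Qed.

Lemma function_functional f A B x y y' :
  function f A B -> maps f x y -> maps f x y' -> y = y'.
Proof.
  intros Hf Hy Hy'.
  destruct (proj2 Hf x (function_domain _ _ _ _ _ Hf Hy)) as (y0 & _ & Hu).
  rewrite <- (Hu y Hy); auto.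
Qed.

Lemma bijection_inj f A B x x' y :
  bijection f A B -> maps f x y -> maps f x' y -> x = x'.
Proof.
  intros [Hf Hb] Hx Hx'.
  destruct (Hb y (function_codomain _ _ _ _ _ Hf Hx)) as (x0 & _ & Hu).
  rewrite <- (Hu x Hx); auto.
Qed.

(** * Natural numbers and finite sets *)

Lemma mem_irrefl n : ~ n ∈ n.
Proof.
  intro H; destruct (singleton_exists n) as [s Hs].
  destruct (ZF_foundation hM s) as (y & Hy & Hd); [exists n; apply Hs; auto|].
  apply Hs in Hy; subst y; apply (Hd n H), Hs; auto.
Qed.

(** Separating the elements that satisfy Q from an inductive set leaves an inductive set, which
    contains every natural number. *)
Lemma natural_ind (Q : M -> (nat -> M) -> Prop) (r : nat -> M) :
  definable (fun r => Q (r 0) (fun i => r (S i))) ->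
  (forall e, is_empty e -> Q e r) ->
  (forall n s, Q n r -> is_succ s n -> Q s r) ->
  forall n, is_natural n -> Q n r.
Proof.
  intros HQ H0 HS n Hn.
  destruct (ZF_infinity hM) as (w & (e & He & Hew) & Hw).
  destruct (separation Q r w HQ) as [b Hb].
  apply (Hb n), Hn; split.
  - exists e; split; [exact He|]; apply Hb; auto.
  - intros m Hm; apply Hb in Hm; destruct Hm as [Hm Qm].
    destruct (Hw m Hm) as (s & Hs & Hsw); exists s; split; [exact Hs|].
    apply Hb; eauto.
Qed.

Lemma natural_empty e : is_empty e -> is_natural e.
Proof.
  intros He w [(e' & He' & Hw) _].
  replace e with e'; [exact Hw|]; apply (ZF_extensionality hM); firstorder.
Qed.

Lemma natural_succ n s : is_natural n -> is_succ s n -> is_natural s.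
Proof.
  intros Hn Hs w Hw; destruct (proj2 Hw n (Hn w Hw)) as (s' & Hs' & Hsw).
  replace s with s'; [exact Hsw|]; apply (ZF_extensionality hM).
  intro t; rewrite (Hs t), (Hs' t); tauto.
Qed.

Lemma finite_empty e : is_empty e -> finite e.
Proof.
  intro He; exists e, e; split; [apply natural_empty, He|].
  split; [split|]; intros t Ht; destruct (He t Ht).
Qed.

Lemma finite_adjoin x a w :
  finite x -> (forall t, t ∈ w <-> t ∈ x \/ t = a) -> finite w.
Proof.
  intros Hx Hw; destruct (classic (a ∈ x)) as [Ha | Ha].
  { replace w with x; [exact Hx|]; apply (ZF_extensionality hM).
    intro t; rewrite (Hw t); intuition congruence. }
  destruct Hx as (n & f & Hn & Hf).
  destruct (adjoin_exists n n) as [s Hs].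
  (* For a new element a, the bijection f onto n is extended by sending a to n, with target n ∪
     {n}. *)
  destruct (graph_exists (fun u t r => maps (r 0) u t \/ u = r 1 /\ t = r 2)
              (scons f (scons a (fun _ => n))) w s) as (g & Hg & Hm);
    [definability | | |].
  - simpl; intros u Hu; apply Hw in Hu.
    destruct (classic (u = a)) as [-> | Hne].
    + exists n; split; [auto|]; intros t [Ht | Ht]; [|intuition congruence].
      destruct Ha; exact (function_domain _ _ _ _ _ (proj1 Hf) Ht).
    + destruct Hu as [Hu | Hu]; [|contradiction].
      destruct (proj2 (proj1 Hf) u Hu) as (t & Ht & Hut); exists t; split; [auto|].
      intros t' [Ht' | Ht']; [auto | tauto].
  - simpl; intros u t _ [Ht | [_ Ht]]; apply Hs; [left | auto].
    exact (function_codomain _ _ _ _ _ (proj1 Hf) Ht).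
  - exists s, g; split; [exact (natural_succ _ _ Hn Hs)|]; split; [exact Hg|].
    intros t Ht; apply Hs in Ht; simpl in Hm.
    destruct (classic (t = n)) as [-> | Hne].
    + exists a; split; [apply Hm; split; [apply Hw|]; auto|].
      intros u Hu; apply Hm in Hu; destruct Hu as [_ [Hu | Hu]]; [|intuition congruence].
      (* The value n is new: if f took it, then n ∈ n. *)
      destruct (mem_irrefl n); exact (function_codomain _ _ _ _ _ (proj1 Hf) Hu).
    + destruct Ht as [Ht | Ht]; [|contradiction].
      destruct (proj2 Hf t Ht) as (u & Hu & Huu); exists u; split.
      * apply Hm; split; [apply Hw; left|left; exact Hu].
        exact (function_domain _ _ _ _ _ (proj1 Hf) Hu).
      * intros u' Hu'; apply Hm in Hu'; destruct Hu' as [_ [Hu' | Hu']]; [auto | tauto].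
Qed.

(** Remove the preimage a of the top element m and restrict f. This undoes one adjunction and drives
    the induction on finite sets. *)
Lemma bijection_succ_remove f x s m :
  bijection f x s -> is_succ s m ->
  exists a x' g, (forall t, t ∈ x <-> t ∈ x' \/ t = a) /\ bijection g x' m.
Proof.
  intros Hf Hs.
  destruct (proj2 Hf m) as (a & Ha & _); [apply Hs; auto|].
  destruct (separation (fun t r => t <> r 0) (fun _ => a) x) as [x' Hx']; [definability|].
  simpl in Hx'.
  destruct (graph_exists (fun u t r => maps (r 0) u t) (fun _ => f) x' m)
    as (g & Hg & Hm); [definability | | |].
  - intros u Hu; apply Hx' in Hu; apply (proj2 (proj1 Hf)); tauto.
  - intros u t Hu Ht; apply Hx' in Hu.
    assert (Hts := function_codomain _ _ _ _ _ (proj1 Hf) Ht); apply Hs in Hts.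
    destruct Hts as [Hts | ->]; [exact Hts|].
    destruct Hu as [_ Hu]; destruct Hu; exact (bijection_inj _ _ _ _ _ _ Hf Ht Ha).
  - exists a, x', g; split; [|split; [exact Hg|]].
    + intro t; rewrite (Hx' t); destruct (classic (t = a)) as [-> | Hne]; [|tauto].
      assert (a ∈ x) by exact (function_domain _ _ _ _ _ (proj1 Hf) Ha); tauto.
    + intros t Ht; destruct (proj2 Hf t) as (u & Hu & Huu); [apply Hs; auto|].
      exists u; split.
      * apply Hm; split; [|exact Hu]; apply Hx'; split.
        -- exact (function_domain _ _ _ _ _ (proj1 Hf) Hu).
        -- intros ->; apply (mem_irrefl m).
           rewrite (function_functional _ _ _ _ _ _ (proj1 Hf) Ha Hu) at 1; exact Ht.
      * intros u' Hu'; apply Hm in Hu'; apply Huu; tauto.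
Qed.

Lemma finite_ind (Q : M -> (nat -> M) -> Prop) (r : nat -> M) :
  definable (fun r => Q (r 1) (fun i => r (S (S (S i))))) ->
  (forall e, is_empty e -> Q e r) ->
  (forall x a w, Q x r -> (forall t, t ∈ w <-> t ∈ x \/ t = a) -> Q w r) ->
  forall x, finite x -> Q x r.
Proof.
  intros HQ H0 HS x (n & f & Hn & Hf); revert x f Hf.
  (* The induction is on the size n, so x and f are quantified inside the formula. There f, x, n
     have indices 0, 1, 2, whence the shift in the hypothesis on Q. *)
  apply (natural_ind (fun n r => forall x f, bijection f x n -> Q x r) r).
  - apply (definable_all (fun x r =>
      forall f, bijection f x (r 0) -> Q x (fun i => r (S i)))).
    apply (definable_all (fun f r =>
      bijection f (r 0) (r 1) -> Q (r 0) (fun i => r (S (S i))))).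
    apply definable_imp; [definability | exact HQ].
  - intros e He x f Hf; apply H0; intros t Ht.
    destruct (proj2 (proj1 Hf) t Ht) as (y & Hy & _).
    exact (He y (function_codomain _ _ _ _ _ (proj1 Hf) Hy)).
  - intros m s IH Hs x f Hf.
    destruct (bijection_succ_remove _ _ _ _ Hf Hs) as (a & x' & g & Hx & Hg).
    exact (HS x' a x (IH x' g Hg) Hx).
  - exact Hn.
Qed.

Lemma finite_subset x y : finite x -> subset y x -> finite y.
Proof.
  intro Hx; revert y.
  apply (finite_ind (fun x _ => forall y, subset y x -> finite y) (fun _ => x));
    [definability | | | exact Hx].
  - intros e He y Hy; apply finite_empty; intros t Ht; exact (He t (Hy t Ht)).
  - intros u a w IH Hw y Hy.
    (* The set y \ {a} lies in the smaller set u; a is put back if y contains it. *)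
    destruct (singleton_exists a) as [s Hs], (diff_exists y s) as [v Hv].
    assert (Hfv : finite v).
    { apply IH; intros t Ht; apply Hv in Ht; destruct Ht as [Ht Hts].
      apply Hy, Hw in Ht; rewrite (Hs t) in Hts; tauto. }
    destruct (classic (a ∈ y)) as [Ha | Ha].
    + apply (finite_adjoin v a y Hfv); intro t; rewrite (Hv t), (Hs t).
      destruct (classic (t = a)); intuition congruence.
    + replace y with v; [exact Hfv|]; apply (ZF_extensionality hM).
      intro t; rewrite (Hv t), (Hs t); intuition congruence.
Qed.

Lemma finite_cup u v w : finite u -> finite v -> is_cup w u v -> finite w.
Proof.
  intros Hu Hv; revert w.
  apply (finite_ind (fun v r => forall w, is_cup w (r 0) v -> finite w) (fun _ => u));
    [definability | | | exact Hv].
  - intros e He w Hw; replace w with u; [exact Hu|]; apply (ZF_extensionality hM).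
    intro t; rewrite (Hw t); specialize (He t); tauto.
  - intros x a y IH Hy w Hw; destruct (cup_exists u x) as [w' Hw'].
    apply (finite_adjoin w' a w (IH w' Hw')).
    intro t; rewrite (Hw t), (Hw' t), (Hy t); tauto.
Qed.

(** * Homogeneity from closure under symmetric difference *)

Lemma symdiff_involutive s x d : is_symdiff s x d -> is_symdiff x s d.
Proof.
  intros Hs t; rewrite (Hs t); destruct (classic (t ∈ x)), (classic (t ∈ d)); tauto.
Qed.

Lemma symdiff_unique s s' x d : is_symdiff s x d -> is_symdiff s' x d -> s = s'.
Proof.
  intros Hs Hs'; apply (ZF_extensionality hM); intro t.
  rewrite (Hs t), (Hs' t); tauto.
Qed.

Lemma symdiff_closed_homogeneous X Z A :
  (forall z, z ∈ Z -> subset z X) ->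
  closed_finite_unions Z ->
  (forall x y, x ∈ Z -> subset y x -> y ∈ Z) ->
  subset A Z ->
  (forall x y s, x ∈ A -> y ∈ A -> is_symdiff s x y -> s ∈ A) ->
  S_homogeneous X Z A.
Proof.
  intros HZX [_ HZU] HZS HAZ Hsd x1 x2 Hx1 Hx2 _.
  destruct (symdiff_exists x1 x2) as [d Hd].
  assert (HdA : d ∈ A) by exact (Hsd _ _ _ Hx1 Hx2 Hd).
  destruct (graph_exists (fun x y r => is_symdiff y x (r 0)) (fun _ => d) A A)
    as (h & Hh & Hm).
  { unfold is_symdiff; definability. }
  { intros x _; destruct (symdiff_exists x d) as [s Hs].
    exists s; split; [exact Hs|]; intros s'; apply symdiff_unique, Hs. }
  { intros x y Hx Hy; exact (Hsd _ _ _ Hx HdA Hy). }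
  (* Being its own inverse makes h bijective and reduces openness to continuity. *)
  assert (Hsym : forall x y, maps h x y -> maps h y x).
  { intros x y Hxy; apply Hm; split; [exact (function_codomain _ _ _ _ _ Hh Hxy)|].
    apply symdiff_involutive, Hm, Hxy. }
  assert (Hc : continuous h A (tau X Z A)).
  { intros V U [HVA HV] HU; split; [intros x Hx; apply HU in Hx; tauto|].
    intros y Hy; apply HU in Hy; destruct Hy as [Hy (v & Hyv & Hv)].
    apply Hm in Hyv; destruct Hyv as [_ Hyv].
    destruct (HV v Hv) as (z & Hz & Hvz & HzV).
    (* The witness at y is w = (z ∪ d) \ y, which lies in Z because d ∈ A ⊆ Z. *)
    destruct (cup_exists z d) as [zd Hzd], (diff_exists zd y) as [w Hw].
    exists w; split; [|split].
    - apply (HZS zd); [exact (HZU z d zd Hz (HAZ d HdA) Hzd)|].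
      intros t Ht; apply Hw in Ht; tauto.
    - intros t Ht Htw; apply Hw in Htw; tauto.
    - intros c Hcw y' Hy' Hyy' Hy'c.
      destruct (symdiff_exists y' d) as [v' Hv'].
      assert (Hv'A : v' ∈ A) by exact (Hsd _ _ _ Hy' HdA Hv').
      (* As y' avoids w and contains y, the two sets agree on z ∪ d. *)
      assert (Hfix : forall t, t ∈ y' -> t ∈ z \/ t ∈ d -> t ∈ y).
      { intros t Ht Htzd; apply NNPP; intro Hty.
        apply Hy'c, Hcw in Ht; apply (proj2 Ht), Hw; split; [apply Hzd|]; auto. }
      apply HU; split; [exact Hy'|]; exists v'; split; [apply Hm; auto|].
      destruct (diff_exists X z) as [b Hb].
      (* With v = y Δ d and v' = y' Δ d: on d the two agree and off d they are y ⊆ y', so v ⊆ v'. On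
         z they also agree, so v' misses z as v does. *)
      apply (HzV b Hb v' Hv'A).
      + intros t Ht; apply Hyv in Ht; apply Hv'.
        specialize (Hfix t); specialize (Hyy' t); tauto.
      + intros t Ht; apply Hb; split; [exact (HZX v' (HAZ v' Hv'A) t Ht)|].
        intro Htz; apply (Hvz t); [|exact Htz].
        apply Hyv; apply Hv' in Ht; specialize (Hfix t); specialize (Hyy' t).
        destruct (classic (t ∈ d)); tauto. }
  exists h; split; [split; [|split]|].
  - split; [exact Hh|]; intros y Hy.
    destruct (proj2 Hh y Hy) as (x & Hx & Hu); exists x; split; auto.
  - exact Hc.
  (* By symmetry of h, the image of U is its preimage. *)
  - intros U V HU HV; apply (Hc U V HU); intro y; rewrite (HV y).
    split; intros [Hy (x & H1 & H2)]; split; eauto.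
  - apply Hm; split; [exact Hx1|]; intro t; rewrite (Hd t).
    destruct (classic (t ∈ x1)), (classic (t ∈ x2)); tauto.
Qed.

(** * Isolated points of the full power set space *)

(** If z witnesses that {X \ x} is open, then X \ z is a point between X \ x and X \ z, hence equals
    X \ x; so z = x. *)
Lemma homogeneous_power X Z P x :
  (forall z, z ∈ Z -> subset z X) -> (exists e, is_empty e /\ e ∈ Z) ->
  is_power P X -> S_homogeneous X Z P -> subset x X -> x ∈ Z.
Proof.
  intros HZX (e & He & HeZ) HP Hhom Hx.
  destruct (diff_exists X x) as [x' Hx'], (singleton_exists X) as [v Hv],
    (singleton_exists x') as [v' Hv'].
  assert (HXP : X ∈ P) by (apply HP; intros t; auto).
  assert (Hx'P : x' ∈ P) by (apply HP; intros t Ht; apply Hx' in Ht; tauto).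
  (* The empty set is a witness, since X is the only subset of X that contains X. *)
  assert (HvO : tau X Z P v).
  { split; [intros t Ht; apply Hv in Ht; subst; exact HXP|].
    intros t Ht; apply Hv in Ht; subst t; exists e; split; [exact HeZ|].
    split; [intros t _; apply He|].
    intros c _ y Hy HXy _; apply Hv, (ZF_extensionality hM); intro t.
    apply HP in Hy; split; auto. }
  assert (Hv'O : tau X Z P v').
  (* Homogeneity speaks of distinct points only, so the case X \ x = X is separate. Otherwise {X \
     x} is the image of {X} under an open map. *)
  { destruct (classic (X = x')) as [Heq | Hne].
    - replace v' with v; [exact HvO|]; apply (ZF_extensionality hM).
      intro t; rewrite (Hv t), (Hv' t), Heq; tauto.
    - destruct (Hhom X x' HXP Hx'P Hne) as (h & ([Hh _] & _ & Ho) & HhX).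
      apply (Ho v v' HvO); intro y; rewrite (Hv' y); split.
      + intros ->; split; [exact Hx'P|]; exists X; split; [apply Hv|]; auto.
      + intros [_ (u & Hu & Huy)]; apply Hv in Hu; subst u.
        exact (function_functional _ _ _ _ _ _ Hh Huy HhX). }
  destruct (proj2 Hv'O x') as (z & Hz & Hd & Hzv); [apply Hv'; auto|].
  destruct (diff_exists X z) as [c Hc].
  assert (Hcx : c = x').
  { apply Hv', (Hzv c Hc).
    - apply HP; intros t Ht; apply Hc in Ht; tauto.
    - intros t Ht; apply Hc; split; [apply Hx' in Ht; tauto | exact (Hd t Ht)].
    - intros t; auto. }
  subst c; replace x with z; [exact Hz|]; apply (ZF_extensionality hM); intro t.
  specialize (Hx t); specialize (HZX z Hz t); specialize (Hc t); specialize (Hx' t).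
  destruct (classic (t ∈ x)), (classic (t ∈ z)); tauto.
Qed.

Lemma empty_exists : exists e : M, is_empty e.
Proof. destruct (ZF_infinity hM) as (w & (e & He & _) & _); eauto. Qed.

End SetTheory.

(** * The three families of subsets *)

Theorem theorem3p5 (M : set_structure) (hM : ZF M) (X Z : M)
  (X_infinite : ~ finite X)
  (Z_sub : forall z, z ∈ Z -> subset z X)
  (Z_unions : closed_finite_unions Z)
  (Z_finite : forall x, subset x X -> finite x -> x ∈ Z) :
  (forall P, is_power P X -> (S_homogeneous X Z P <-> Z = P)) /\
  (forall A, bornology Z X -> bornology A X -> subset A Z ->
     S_homogeneous X Z A) /\
  (forall F, is_finite_subsets F X -> bornology Z X -> S_homogeneous X Z F).
Proof.
  (* A family closed under subsets and binary unions is therefore closed under symmetric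
     difference. *)
  assert (Hcup : forall s x y w : M, is_symdiff s x y -> is_cup w x y -> subset s w).
  { intros s x y w Hs Hw t Ht; apply Hs in Ht; apply Hw.
    destruct (classic (t ∈ x)), (classic (t ∈ y)); tauto. }
  split; [|split].
  - intros P HP; split.
    + intro Hhom; apply (ZF_extensionality hM); intro x; rewrite (HP x); split.
      * apply Z_sub.
      * intro Hx; apply (homogeneous_power hM X Z P x); auto.
        destruct (empty_exists hM) as [e He]; exists e; split; [exact He|].
        apply Z_unions, He.
    (* Here Z itself is the power set and also serves as the family A. *)
    + intros <-; apply (symdiff_closed_homogeneous hM); auto.
      * intros x y Hx Hy; apply HP; intros t Ht; exact (Z_sub x Hx t (Hy t Ht)).
      * intros t; auto.
      * intros x y s Hx Hy Hs; destruct (cup_exists hM x y) as [w Hw].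
        apply HP; intros t Ht; apply (Hcup s x y w Hs Hw), Hw in Ht.
        destruct Ht as [Ht | Ht]; [exact (Z_sub x Hx t Ht) | exact (Z_sub y Hy t Ht)].
  - intros A (_ & HZ & _) (_ & HA & [_ HAU] & _) HAZ.
    apply (symdiff_closed_homogeneous hM); auto.
    intros x y s Hx Hy Hs; destruct (cup_exists hM x y) as [w Hw].
    apply (HA w); [exact (HAU x y w Hx Hy Hw) | exact (Hcup s x y w Hs Hw)].
  (* The finite subsets lie in Z by [Z_finite]; their symmetric differences are finite as subsets of
     finite unions. *)
  - intros F HF (_ & HZ & _); apply (symdiff_closed_homogeneous hM); auto.
    + intros x Hx; apply HF in Hx; apply Z_finite; tauto.
    + intros x y s Hx Hy Hs; destruct (cup_exists hM x y) as [w Hw].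
      apply HF in Hx, Hy; apply HF; split.
      * intros t Ht; apply (Hcup s x y w Hs Hw), Hw in Ht.
        destruct Ht as [Ht | Ht]; [apply (proj1 Hx t Ht) | apply (proj1 Hy t Ht)].
      * apply (finite_subset hM w); [|exact (Hcup s x y w Hs Hw)].
        exact (finite_cup hM x y w (proj2 Hx) (proj2 Hy) Hw).
Qed.
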